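(* Let $X$ be a real Hilbert space, let $\gamma<0$, let $\tilde u_0,\tilde v_0\in X$, and let $\tilde C_\gamma=\{(u,v)\in X\times X : \|u\|^2-\|v\|^2=2\gamma\}$. Then the following hold. (i) When $\tilde u_0\neq 0$ and $\tilde v_0\neq 0$, $$P_{\tilde C_\gamma}(\tilde u_0,\tilde v_0)=\left\{\left(\frac{\tilde u_0}{1-\lambda},\ \frac{\tilde v_0}{1+\lambda}\right)\right\},$$ where $\lambda$ is the unique root of $H(\lambda)=0$ in the open interval $(-1,1)$, with $$H(\lambda)=\frac{(\lambda^2+1)p-2\lambda q}{2(1-\lambda^2)^2}+\gamma,\qquad p=\|\tilde v_0\|^2-\|\tilde u_0\|^2,\qquad q=\|\tilde u_0\|^2+\|\tilde v_0\|^2.$$ (ii) When $\tilde v_0=0$, $$P_{\tilde C_\gamma}(\tilde u_0,0)=\left\{\left(\frac{\tilde u_0}{2},\ \tilde v\right) : \tilde v\in X,\ \|\tilde v\|^2=\frac{\|\tilde u_0\|^2}{4}-2\gamma\right\}.$$ (iii) a) When $\tilde u_0=0$ and $\|\tilde v_0\|\ge 2\sqrt{2(-\gamma)}$, $$P_{\tilde C_\gamma}(0,\tilde v_0)=\left\{\left(\tilde u,\ \frac{\tilde v_0}{2}\right) : \tilde u\in X,\ \|\tilde u\|^2=\frac{\|\tilde v_0\|^2}{4}+2\gamma\right\}.$$ b) When $\tilde u_0=0$ and $0<\|\tilde v_0\|<2\sqrt{2(-\gamma)}$, $$P_{\tilde C_\gamma}(0,\tilde v_0)=\left\{\left(0,\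 \sqrt{2(-\gamma)}\,\frac{\tilde v_0}{\|\tilde v_0\|}\right)\right\}.$$
   Context: $X$ is a real Hilbert space with induced norm $\|\cdot\|$. The product $X\times X$ carries the norm $\|(u,v)\|^2=\|u\|^2+\|v\|^2$. For a set $S\subseteq X\times X$ and a point $z\in X\times X$, $P_S(z)$ denotes the (possibly empty, possibly multi-valued) set of nearest points: $P_S(z)=\{s\in S : \|z-s\|\le\|z-s'\|\text{ for all }s'\in S\}$. *)

(* Defs.v *)
From mathcomp Require Import all_boot all_order all_algebra.
From mathcomp Require Import all_classical all_reals all_analysis.

Set Implicit Arguments.
Unset Strict Implicit.
Unset Printing Implicit Defensive.

Import Order.TTheory GRing.Theory Num.Theory.
Import numFieldNormedType.Exports.

Local Open Scope classical_set_scope.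
Local Open Scope ring_scope.

(* The library norm on [X * X] is the max norm, hence a separate definition of
   the Hilbert norm on the product. *)
Definition prod_norm (R : realType) (X : normedModType R) (z : X * X) : R :=
  Num.sqrt (`|z.1| ^+ 2 + `|z.2| ^+ 2).

Definition nearest_points (R : realType) (X : normedModType R)
    (S : set (X * X)) (z : X * X) : set (X * X) :=
  [set s | S s /\ forall s', S s' -> prod_norm (z - s) <= prod_norm (z - s')].

Definition Ctilde (R : realType) (X : normedModType R) (gamma : R) :
    set (X * X) :=
  [set w | `|w.1| ^+ 2 - `|w.2| ^+ 2 = 2 * gamma].

Definition Hfun (R : realType) (X : normedModType R) (gamma : R) (u0 v0 : X)
    (lambda : R) : R :=
  let p := `|v0| ^+ 2 - `|u0| ^+ 2 in
  let q := `|u0| ^+ 2 + `|v0| ^+ 2 in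
  ((lambda ^+ 2 + 1) * p - 2 * lambda * q) / (2 * (1 - lambda ^+ 2) ^+ 2)
  + gamma.

(* Main.v *)
Require Import Defs.
From mathcomp Require Import all_boot all_order all_algebra.
From mathcomp Require Import all_classical all_reals all_analysis.
From mathcomp Require Import ring lra.

Set Implicit Arguments.
Unset Strict Implicit.
Unset Printing Implicit Defensive.

Import Order.TTheory GRing.Theory Num.Theory.
Import numFieldNormedType.Exports.

Local Open Scope classical_set_scope.
Local Open Scope ring_scope.

(** The problem minimises a quadratic distance over the level set of a
    quadratic form, and although that set is not convex the Lagrangian is
    explicitly a sum of squares.  Let [w] lie on [Ctilde gamma] and suppose that
    [(u0, v0) = ((1 - lambda) w.1, (1 + lambda) w.2)], which is the Lagrange
    condition at [w] with multiplier [lambda].  For each [s] on [Ctilde gamma]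
    the constraint terms cancel, and completing the square leaves
      [|z - s|^2 - |z - w|^2
         = (1 - lambda) |s.1 - w.1|^2 + (1 + lambda) |s.2 - w.2|^2]
    with [z = (u0, v0)] ([sqr_dist_stationary]).  When [-1 <= lambda <= 1] both
    weights are nonnegative, so [w] is a global minimiser and the other
    minimisers are the points of [Ctilde gamma] that differ from [w] only in a
    coordinate of zero weight ([nearest_points_stationary]).

    The four cases are then four choices of the multiplier.  If [u0] and [v0]
    are nonzero, [lambda] is a root of [H] in [(-1, 1)]: being a root says that
    the stationary point lies on [Ctilde gamma] ([Hfun_eq0]), and a root exists
    by the intermediate value theorem ([Hfun_root]).  Both weights are positive,
    so the nearest point is unique, and this also makes the root unique, as
    different roots would give different nearest points.  If [v0 = 0] or
    [u0 = 0] with [v0] large, the multiplier sits at the endpoint [-1] or [1],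
    one coordinate is constrained only through its norm, and a sphere of
    minimisers appears.  If [u0 = 0] with [v0] small and nonzero, the stationary
    point is [(0, v)] with [v] on the ray of [v0], and
    [1 + lambda = |v0| / sqrt (- 2 gamma)] lies in [(0, 2)]. *)

(** The Hilbert structure enters the argument only through this expansion. *)
Lemma sqr_norm_scaleD (R : realType) (X : normedModType R)
    (dot : {dot X for idfun}) (dotE : forall x : X, `|x| = Num.sqrt (dot x x))
    (a : R) (x y : X) :
  `|a *: x + y| ^+ 2 = a ^+ 2 * `|x| ^+ 2 + 2 * a * dot x y + `|y| ^+ 2.
Proof.
have sqrE z : `|z| ^+ 2 = dot z z.
  rewrite dotE sqr_sqrtr //.
  by have [->|/neq0_dnorm_gt0 /ltW//] := eqVneq z 0; rewrite linear0l.
have dotZl b z t : dot (b *: z) t = b * dot z t by rewrite linearZl_LR.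
have dotZr b z t : dot z (b *: t) = b * dot z t by rewrite linearZr_LR.
rewrite !sqrE linearDl /= !linearDr /= !dotZl !dotZr.
by rewrite [dot y x]hermC /= expr0 mul1r; ring.
Qed.

(** Completing the square in one coordinate, with the constraint term
    [t (|y|^2 - |x|^2)] split off: at [y = x] the right-hand side is its first
    term, so the other two measure the excess over [x]. *)
Lemma sqr_norm_complete (R : realType) (X : normedModType R)
    (dot : {dot X for idfun}) (dotE : forall x : X, `|x| = Num.sqrt (dot x x))
    (t : R) (x y : X) :
  `|(1 - t) *: x - y| ^+ 2 =
    `|(1 - t) *: x - x| ^+ 2 + (1 - t) * `|y - x| ^+ 2
    + t * (`|y| ^+ 2 - `|x| ^+ 2).
Proof.
have -> : (1 - t) *: x - x = (- t) *: x + 0.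
  by rewrite addr0 scalerBl scale1r scaleNr addrAC subrr add0r.
have -> : y - x = (-1) *: x + y by rewrite scaleN1r addrC.
rewrite !(sqr_norm_scaleD dotE) normrN linear0r linearNr /= normr0; ring.
Qed.

Definition sqr_dist (R : realType) (X : normedModType R) (z s : X * X) : R :=
  `|z.1 - s.1| ^+ 2 + `|z.2 - s.2| ^+ 2.

Lemma ler_prod_norm (R : realType) (X : normedModType R) (z s s' : X * X) :
  (prod_norm (z - s) <= prod_norm (z - s')) = (sqr_dist z s <= sqr_dist z s').
Proof. by rewrite /prod_norm ler_sqrt // addr_ge0 ?sqr_ge0. Qed.

(** The sum of [sqr_norm_complete] over the two coordinates, with multipliers
    [lambda] and [- lambda]; the constraint terms cancel because [s] and [w]
    give the quadratic form the same value. *)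
Lemma sqr_dist_stationary (R : realType) (X : normedModType R)
    (dot : {dot X for idfun}) (dotE : forall x : X, `|x| = Num.sqrt (dot x x))
    (gamma lambda : R) (w s : X * X) :
  Ctilde gamma w -> Ctilde gamma s ->
  let z := ((1 - lambda) *: w.1, (1 + lambda) *: w.2) in
  sqr_dist z s = sqr_dist z w + (1 - lambda) * `|s.1 - w.1| ^+ 2
                 + (1 + lambda) * `|s.2 - w.2| ^+ 2.
Proof.
rewrite /Ctilde /= => Cw Cs; rewrite /sqr_dist /=.
have := sqr_norm_complete dotE lambda w.1 s.1.
have := sqr_norm_complete dotE (- lambda) w.2 s.2.
rewrite opprK => -> ->.
have : lambda * (`|s.1| ^+ 2 - `|s.2| ^+ 2)
     = lambda * (`|w.1| ^+ 2 - `|w.2| ^+ 2) by rewrite Cs Cw.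
lra.
Qed.

Lemma weighted_sqr_dist_eq0 (R : realType) (X : normedModType R)
    (c : R) (x y : X) :
  (c * `|x - y| ^+ 2 == 0) = (c *: x == c *: y).
Proof.
by rewrite mulf_eq0 sqrf_eq0 normr_eq0 -[RHS]subr_eq0 -scalerBr scaler_eq0.
Qed.

(** A stationary point whose multiplier lies in [[-1, 1]] determines all nearest
    points: they are the points of the level set satisfying the same Lagrange
    equations, so only a coordinate with a vanishing weight is free. *)
Lemma nearest_points_stationary (R : realType) (X : normedModType R)
    (dot : {dot X for idfun}) (dotE : forall x : X, `|x| = Num.sqrt (dot x x))
    (gamma lambda : R) (w : X * X) :
  -1 <= lambda <= 1 -> Ctilde gamma w ->
  let z := ((1 - lambda) *: w.1, (1 + lambda) *: w.2) in
  nearest_points (Ctilde gamma) z =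
  [set s | Ctilde gamma s /\
     (1 - lambda) *: s.1 = z.1 /\ (1 + lambda) *: s.2 = z.2].
Proof.
move=> /andP[lambda_geN1 lambda_le1] Cw z.
have weightl (s : X * X) : 0 <= (1 - lambda) * `|s.1 - w.1| ^+ 2.
  by rewrite mulr_ge0 ?sqr_ge0 // subr_ge0.
have weightr (s : X * X) : 0 <= (1 + lambda) * `|s.2 - w.2| ^+ 2.
  by rewrite mulr_ge0 ?sqr_ge0 // addrC -lerBlDr sub0r.
have distE s : Ctilde gamma s -> sqr_dist z s = sqr_dist z w
    + (1 - lambda) * `|s.1 - w.1| ^+ 2 + (1 + lambda) * `|s.2 - w.2| ^+ 2.
  exact: sqr_dist_stationary.
apply/seteqP; split=> s /= [Cs].
  move=> /(_ w Cw); rewrite ler_prod_norm distE // => s_min.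
  have := weightl s; have := weightr s => sr sl; split=> //.
  by split; apply/eqP; rewrite -weighted_sqr_dist_eq0 eq_le; lra.
move=> [/eqP]; rewrite -weighted_sqr_dist_eq0 => /eqP eq1.
move=> /eqP; rewrite -weighted_sqr_dist_eq0 => /eqP eq2.
split=> // s' Cs'; rewrite ler_prod_norm (distE s) // (distE s') // eq1 eq2.
by have := weightl s'; have := weightr s'; lra.
Qed.

(** In the interior of the multiplier interval both weights are positive. *)
Lemma nearest_points_stationary_unique (R : realType) (X : normedModType R)
    (dot : {dot X for idfun}) (dotE : forall x : X, `|x| = Num.sqrt (dot x x))
    (gamma lambda : R) (u0 v0 : X) (w := ((1 - lambda)^-1 *: u0,
                                          (1 + lambda)^-1 *: v0)) :
  -1 < lambda < 1 -> Ctilde gamma w ->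
  nearest_points (Ctilde gamma) (u0, v0) = [set w].
Proof.
move=> /andP[lambda_gtN1 lambda_lt1] Cw.
have cl : 1 - lambda != 0 by apply/eqP; lra.
have cr : 1 + lambda != 0 by apply/eqP; lra.
have zE : (u0, v0) = ((1 - lambda) *: w.1, (1 + lambda) *: w.2).
  by rewrite /w /= !scalerA !divff // !scale1r.
have lambda_in : -1 <= lambda <= 1 by rewrite !ltW.
rewrite zE (nearest_points_stationary dotE lambda_in Cw).
apply/seteqP; split=> [[u v] /= [_ []]|s /= ->]; last by [].
by move=> /(scalerI cl) -> /(scalerI cr) ->.
Qed.

Lemma exists_sqr_norm (R : realType) (X : normedModType R) (x : X) (r : R) :
  x != 0 -> 0 <= r -> exists y : X, `|y| ^+ 2 = r.
Proof.
move=> x_neq0 r_ge0; exists ((Num.sqrt r / `|x|) *: x).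
by rewrite normrZ normrM normfV normr_id divfK ?normr_eq0 // ger0_norm
  ?sqrtr_ge0 // sqr_sqrtr.
Qed.

(** [H] vanishes exactly when the stationary point satisfies the constraint:
    [H] is [gamma] minus half the quadratic form at that point. *)
Lemma Hfun_eq0 (R : realType) (X : normedModType R) (gamma : R) (u0 v0 : X)
    (lambda : R) :
  -1 < lambda < 1 ->
  Hfun gamma u0 v0 lambda = 0 <->
  Ctilde gamma ((1 - lambda)^-1 *: u0, (1 + lambda)^-1 *: v0).
Proof.
move=> /andP[lambda_gtN1 lambda_lt1].
have cl : 1 - lambda != 0 by apply/eqP; lra.
have cr : 1 + lambda != 0 by apply/eqP; lra.
have cc : 1 - lambda ^+ 2 != 0.
  by rewrite -[1](expr1n _ 2) subr_sqr mulf_neq0.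
rewrite /Ctilde /= !normrZ !exprMn !real_normK ?num_real //.
have -> : Hfun gamma u0 v0 lambda =
    gamma - ((1 - lambda)^-1 ^+ 2 * `|u0| ^+ 2
             - (1 + lambda)^-1 ^+ 2 * `|v0| ^+ 2) / 2.
  by rewrite /Hfun; field; rewrite cl cr cc.
by split=> ?; lra.
Qed.

(** Clearing denominators in the constraint at the stationary point gives a
    polynomial that is [- 4 |v0|^2] at [-1] and [4 |u0|^2] at [1]. *)
Lemma Hfun_root (R : realType) (X : normedModType R) (gamma : R) (u0 v0 : X) :
  u0 != 0 -> v0 != 0 ->
  exists2 lambda : R, -1 < lambda < 1 & Hfun gamma u0 v0 lambda = 0.
Proof.
rewrite -!normr_gt0 => /(exprn_gt0 2) u0_gt0 /(exprn_gt0 2) v0_gt0.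
pose Q : {poly R} := `|u0| ^+ 2 *: (1 + 'X) ^+ 2 - `|v0| ^+ 2 *: (1 - 'X) ^+ 2
  - (2 * gamma) *: (1 - 'X ^+ 2) ^+ 2.
have QE x : Q.[x] = `|u0| ^+ 2 * (1 + x) ^+ 2 - `|v0| ^+ 2 * (1 - x) ^+ 2
    - 2 * gamma * (1 - x ^+ 2) ^+ 2.
  by rewrite /Q !hornerE.
have [||lambda /andP[lambda_geN1 lambda_le1] /rootP] := @poly_ivt R Q (-1) 1.
- lra.
- by rewrite !QE; apply/andP; split; nra.
rewrite QE => Q0.
have lambda_neN1 : lambda != -1.
  by apply/eqP => lambdaE; move: Q0; rewrite lambdaE; nra.
have lambda_ne1 : lambda != 1.
  by apply/eqP => lambdaE; move: Q0; rewrite lambdaE; nra.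
have lambda_in : -1 < lambda < 1.
  by rewrite !lt_neqAle lambda_geN1 lambda_le1 eq_sym lambda_neN1 lambda_ne1.
exists lambda => //.
have cc : 1 - lambda ^+ 2 != 0.
  by rewrite -[1](expr1n _ 2) subr_sqr mulf_neq0 //; apply/eqP; lra.
rewrite /Hfun; apply: (mulfI (x := 2 * (1 - lambda ^+ 2) ^+ 2)).
  by rewrite mulf_neq0 ?expf_neq0 // pnatr_eq0.
rewrite mulr0 -[0]oppr0 -Q0; field; exact: cc.
Qed.

(* [X] is a Hilbert space: a complete normed space whose norm is induced by the
   inner product [dot]. *)
Theorem theorem5p1 (R : realType) (X : completeNormedModType R)
    (dot : {dot X for idfun}) (dotE : forall x : X, `|x| = Num.sqrt (dot x x))
    (gamma : R) (gamma_lt0 : gamma < 0) (u0 v0 : X) :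
  [/\ (u0 != 0 -> v0 != 0 ->
       exists lambda : R,
         [/\ -1 < lambda < 1, Hfun gamma u0 v0 lambda = 0,
             (forall mu : R, -1 < mu < 1 -> Hfun gamma u0 v0 mu = 0 ->
                mu = lambda)
           & nearest_points (Ctilde gamma) (u0, v0) =
             [set ((1 - lambda)^-1 *: u0, (1 + lambda)^-1 *: v0)]]),
      (v0 = 0 ->
       nearest_points (Ctilde gamma) (u0, 0) =
       [set (2^-1 *: u0, v) | v in
          [set v : X | `|v| ^+ 2 = `|u0| ^+ 2 / 4 - 2 * gamma]]),
      (u0 = 0 -> 2 * Num.sqrt (2 * - gamma) <= `|v0| ->
       nearest_points (Ctilde gamma) (0, v0) =
       [set (u, 2^-1 *: v0) | u in
          [set u : X | `|u| ^+ 2 = `|v0| ^+ 2 / 4 + 2 * gamma]])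
    & (u0 = 0 -> 0 < `|v0| < 2 * Num.sqrt (2 * - gamma) ->
       nearest_points (Ctilde gamma) (0, v0) =
       [set (0, (Num.sqrt (2 * - gamma) / `|v0|) *: v0)])].
Proof.
split.
- move=> u0_neq0 v0_neq0.
  have [lambda lambda_in H0] := Hfun_root gamma u0_neq0 v0_neq0.
  have nearestE mu (mu_in : -1 < mu < 1) (H0mu : Hfun gamma u0 v0 mu = 0) :=
    nearest_points_stationary_unique dotE mu_in ((Hfun_eq0 _ _ _ mu_in).1 H0mu).
  exists lambda; split=> [//|//|mu mu_in H0mu|]; last exact: nearestE.
  (* Two roots would give two descriptions of the same singleton, and [u0 != 0]
     recovers the multiplier from the first coordinate. *)
  have := nearestE mu mu_in H0mu; rewrite (nearestE lambda) //.
  move=> /seteqP[/(_ _ erefl)] [/eqP + _] _.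
  rewrite -subr_eq0 -scalerBl scaler_eq0 (negPf u0_neq0).
  by rewrite orbF subr_eq0 => /eqP/invr_inj; lra.
- move=> _.
  have keyE (v : X) : `|v| ^+ 2 = `|u0| ^+ 2 / 4 - 2 * gamma ->
      nearest_points (Ctilde gamma) (u0, 0) = [set (2^-1 *: u0, v) | v in
          [set v : X | `|v| ^+ 2 = `|u0| ^+ 2 / 4 - 2 * gamma]].
    move=> vE.
    have CE (x : X) : Ctilde gamma (2^-1 *: u0, x) <->
        `|x| ^+ 2 = `|u0| ^+ 2 / 4 - 2 * gamma.
      rewrite /Ctilde /= normrZ ger0_norm ?invr_ge0 ?ler0n //.
      by split=> ?; lra.
    have zE : (u0, 0) = ((1 - -1) *: (2^-1 *: u0), (1 + -1) *: v) :> X * X.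
      by rewrite opprK subrr scale0r scalerA divff ?pnatr_eq0 // scale1r.
    have Cv := (CE v).2 vE.
    have mult_in : -1 <= (-1 : R) <= 1 by lra.
    rewrite zE (nearest_points_stationary dotE mult_in Cv) /=.
    rewrite opprK subrr scale0r.
    apply/seteqP; split=> [[u x] /= [+ [/scalerI uE _]]|s /= [x xE <-]].
      by rewrite uE ?pnatr_eq0 // => /CE xE; exists x.
    by rewrite scale0r; split; first exact/CE.
  (* When [X = {0}] both sides are empty, so a point of the sphere is extracted
     from a member of either side rather than constructed outright. *)
  apply/seteqP; split=> s Hs; last by case: (Hs) => x xE _; rewrite (keyE x).
  have s2_neq0 : s.2 != 0.
    case: Hs; rewrite /Ctilde /= => Cs _; apply/eqP => s20.
    by move: Cs; rewrite s20 normr0 expr0n /=; have := sqr_ge0 `|s.1|; lra.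
  have [|x xE] := exists_sqr_norm (r := `|u0| ^+ 2 / 4 - 2 * gamma) s2_neq0.
    by have := sqr_ge0 `|u0|; lra.
  by rewrite -(keyE x).
- move=> _ v0_large.
  have sqrt_gt0 : 0 < Num.sqrt (2 * - gamma) by rewrite sqrtr_gt0; lra.
  have sqrtE : Num.sqrt (2 * - gamma) ^+ 2 = 2 * - gamma.
    by rewrite sqr_sqrtr //; lra.
  have v0_neq0 : v0 != 0 by rewrite -normr_gt0; lra.
  have [|u uE] := exists_sqr_norm (r := `|v0| ^+ 2 / 4 + 2 * gamma) v0_neq0.
    by nra.
  have CE (x : X) : Ctilde gamma (x, 2^-1 *: v0) <->
      `|x| ^+ 2 = `|v0| ^+ 2 / 4 + 2 * gamma.
    rewrite /Ctilde /= normrZ ger0_norm ?invr_ge0 ?ler0n //.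
    by split=> ?; lra.
  have zE : (0, v0) = ((1 - 1) *: u, (1 + 1) *: (2^-1 *: v0)) :> X * X.
    by rewrite subrr scale0r scalerA divff ?pnatr_eq0 // scale1r.
  have Cu := (CE u).2 uE.
  have mult_in : -1 <= (1 : R) <= 1 by lra.
  rewrite zE (nearest_points_stationary dotE mult_in Cu) /=.
  rewrite subrr scale0r.
  apply/seteqP; split=> [[x v] /= [+ [_ /scalerI vE]]|s /= [x xE <-]].
    by rewrite vE ?pnatr_eq0 // => /CE xE; exists x.
  by rewrite scale0r; split; first exact/CE.
- move=> _ /andP[v0_gt0 v0_small].
  have sqrt_gt0 : 0 < Num.sqrt (2 * - gamma) by rewrite sqrtr_gt0; lra.
  have sqrtE : Num.sqrt (2 * - gamma) ^+ 2 = 2 * - gamma.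
    by rewrite sqr_sqrtr //; lra.
  pose lambda := `|v0| / Num.sqrt (2 * - gamma) - 1.
  have cE : (1 + lambda)^-1 = Num.sqrt (2 * - gamma) / `|v0|.
    by rewrite /lambda addrC subrK invf_div.
  have lambda_in : -1 < lambda < 1.
    have : 0 < `|v0| / Num.sqrt (2 * - gamma) by rewrite divr_gt0.
    have : `|v0| / Num.sqrt (2 * - gamma) < 2 by rewrite ltr_pdivrMr.
    by rewrite /lambda; lra.
  rewrite (nearest_points_stationary_unique dotE lambda_in) scaler0 cE //.
  rewrite /Ctilde /= normrZ normrM normfV normr_id divfK ?gt_eqF //.
  by rewrite normr0 expr0n /= ger0_norm ?ltW // sqrtE; lra.
Qed.
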